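(* Let $A=(a_{ij})$ be a $3\times3$ Cartan matrix of infinite type and $p$ any prime. If the principal submatrix $A_{12}$ is also of infinite type (i.e. $a_{12}a_{21}\ge4$), then $$\mathbb{Q}[\omega_1,\omega_2,\omega_3]=\mathbb{Q}[\omega_1,\omega_2,\omega_3]^{\langle\sigma_1\rangle}+\mathbb{Q}[\omega_1,\omega_2,\omega_3]^{\langle\sigma_2\rangle}=\mathbb{Q}[\omega_1(\omega_1-\alpha_1),\omega_2,\omega_3]+\mathbb{Q}[\omega_1,\omega_2(\omega_2-\alpha_2),\omega_3],$$ whereas $$\mathbb{F}_p[\omega_1,\omega_2,\omega_3]\neq \mathbb{F}_p[\omega_1(\omega_1-\alpha_1),\omega_2,\omega_3]+\mathbb{F}_p[\omega_1,\omega_2(\omega_2-\alpha_2),\omega_3].$$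
   Context: A $3\times 3$ (generalized) Cartan matrix $A=(a_{ij})$ is an integer matrix with $a_{ii}=2$, $a_{ij}\le 0$ for $i\ne j$, $a_{ij}=0\iff a_{ji}=0$; infinite type means indecomposable and not of finite type. Here $\omega_1,\omega_2,\omega_3$ are polynomial generators of degree 2 (so $H^*(BT;R)=R[\omega_1,\omega_2,\omega_3]$ for the maximal torus $T$ of the Kac–Moody group of $A$), $\alpha_j=\sum_{i=1}^3 a_{ij}\omega_i$, and the Weyl reflections act by $\sigma_j(\omega_j)=\omega_j-\alpha_j$, $\sigma_j(\omega_i)=\omega_i$ for $i\ne j$. Sums are sums of subspaces. *)

(* Defs.v *)
From HB Require Import structures.
From mathcomp Require Import all_boot all_order all_algebra.
From mathcomp Require Import mpoly.
Set Implicit Arguments. Unset Strict Implicit. Unset Printing Implicit Defensive.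
Import Order.TTheory GRing.Theory Num.Theory.
Local Open Scope ring_scope.

(* Indices 1,2,3 of the paper are the ordinals 0,1,2 of 'I_3. *)

Definition is_gcm (A : 'M[int]_3) : Prop :=
  (forall i, A i i = 2) /\
  (forall i j, i != j -> A i j <= 0) /\
  (forall i j, A i j = 0 <-> A j i = 0).

Definition indecomposable (A : 'M[int]_3) : Prop :=
  ~ exists S : {set 'I_3}, [/\ S != set0, S != setT &
       forall i j, i \in S -> j \notin S -> A i j = 0].

Definition principal_minor (A : 'M[int]_3) (S : {set 'I_3}) : int :=
  \det (\matrix_(i < #|S|, j < #|S|) A (enum_val i) (enum_val j)).

(* finite type (indecomposable GCM): all principal minors positive (Kac, Lemma 4.5) *)
Definition finite_type (A : 'M[int]_3) : Prop :=
  forall S : {set 'I_3}, S != set0 -> 0 < principal_minor A S.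

Definition infinite_type (A : 'M[int]_3) : Prop :=
  is_gcm A /\ indecomposable A /\ ~ finite_type A.

Section Weyl.
Variable R : comRingType.

Definition omega (i : 'I_3) : {mpoly R[3]} := 'X_i.

Definition alpha (A : 'M[int]_3) (j : 'I_3) : {mpoly R[3]} :=
  \sum_(i < 3) (A i j)%:~R *: omega i.

Definition sigma (A : 'M[int]_3) (j : 'I_3) (p : {mpoly R[3]}) : {mpoly R[3]} :=
  comp_mpoly [tuple (if i == j then omega i - alpha A j else omega i) | i < 3] p.

Definition invariants (A : 'M[int]_3) (j : 'I_3) : {mpoly R[3]} -> Prop :=
  fun p => forall n : nat, iter n (sigma A j) p = p.

Definition subalg3 (f0 f1 f2 : {mpoly R[3]}) : {mpoly R[3]} -> Prop :=
  fun p => exists q : {mpoly R[3]}, p = comp_mpoly [tuple f0; f1; f2] q.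

Definition sumsp (U V : {mpoly R[3]} -> Prop) : {mpoly R[3]} -> Prop :=
  fun p => exists u v, [/\ U u, V v & p = u + v].

Definition alg_sum (A : 'M[int]_3) : {mpoly R[3]} -> Prop :=
  let i0 : 'I_3 := 0%R in let i1 : 'I_3 := 1%R in let i2 : 'I_3 := 2%R in
  sumsp (subalg3 (omega i0 * (omega i0 - alpha A i0)) (omega i1) (omega i2))
        (subalg3 (omega i0) (omega i1 * (omega i1 - alpha A i1)) (omega i2)).

End Weyl.

(* Main.v *)
(** Write x, y, z for the three generators, b = - a_21 and a = - a_12, so that modulo z the two
    subalgebras are U = R[x(by - x), y] and V = R[x, y(ax - y)].

    Over Q, induction on the degree reduces the claim U + V = everything to the case z = 0.  In degree n
    one has n + 1 spanning elements (see [refl_gen]), so it is enough that they are linearly independent.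
    A linear relation produces a form g of degree n in U and V, hence invariant under both reflections,
    that vanishes at (1, 0).  It then vanishes on the whole orbit of (1, 0).  That orbit meets infinitely
    many lines as ab >= 4: its points keep the quadratic form ax^2 - abxy + by^2 constant while x increases
    strictly.  Therefore g = 0.

    Over F_p, put z = 0.  The form w = x^p y - x y^p over the field with p^2 elements changes sign under
    every matrix of GL_2(F_p) of determinant - 1, so f |-> sum_{(x, y)} f(x, y) w(x, y) kills U and V but
    not x^(q-1-p) y^(q-2), where q = p^2.  This breaks down only for p = 2 with a or b even, when a
    reflection becomes trivial modulo p; there the coefficient of x y^3 or of x^3 y separates. *)
Require Import Defs.
From HB Require Import structures.
From mathcomp Require Import all_boot all_order all_algebra.
From mathcomp Require Import fraction mpoly finfield ring lra zify.
Import Order.TTheory GRing.Theory Num.Theory.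
Local Open Scope ring_scope.

(** Degree [n] elements of the two subalgebras modulo z, indexed by [k <= n]: the powers of the second
    quadratic invariant for [k <= n/2], those of the first one for [k > n/2].  In the latter range
    [k.*2 - n > 0], i.e. the top power of x(by - x) is left out when [n] is even. *)
Definition refl_gen {S : comNzRingType} (a b x y : S) (n k : nat) : S :=
  if (k <= n./2)%N then x ^+ (n - k.*2) * (y * (a * x - y)) ^+ k
  else y ^+ (k.*2 - n) * (x * (b * y - x)) ^+ (n - k).

Lemma rmorph_refl_gen (S S' : comNzRingType) (f : {rmorphism S -> S'}) a b x y n k :
  f (refl_gen a b x y n k) = refl_gen (f a) (f b) (f x) (f y) n k.
Proof.
by rewrite /refl_gen; case: ifP => _; rewrite !(rmorphM, rmorphXn, rmorphB).
Qed.

(** Each generator is a form of degree [n] in [x] and [y]; this is the passage between forms and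
    polynomials in the slope [y / x]. *)
Lemma refl_gen_homog (K : fieldType) (a b x y : K) n k : (k <= n)%N -> x != 0 ->
  x ^+ n * refl_gen a b 1 (y / x) n k = refl_gen a b x y n k.
Proof.
move=> le_kn x0; rewrite /refl_gen; case: leqP => hk.
- have hk2 : (k.*2 <= n)%N by lia.
  rewrite expr1n mul1r -{1}(subnK hk2) exprD -mulrA; congr (_ * _).
  by rewrite -mul2n exprM -exprMn; congr (_ ^+ _); field.
- have -> : x ^+ n = x ^+ (k.*2 - n) * (x ^+ 2) ^+ (n - k).
    by rewrite -exprM -exprD; congr (_ ^+ _); lia.
  by rewrite mulrACA -!exprMn; congr (_ ^+ _ * _ ^+ _); field.
Qed.

(** * The orbit of (1, 0) under the product of the two reflections *)

Section Orbit.
Variables (F : realFieldType) (a b : F).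
Hypotheses (a_gt0 : 0 < a) (b_gt0 : 0 < b) (ab_ge4 : 4 <= a * b).

Definition coxeter_step (P : F * F) : F * F :=
  let y := a * P.1 - P.2 in (b * y - P.1, y).

Definition coxeter_orbit k := iter k coxeter_step (1, 0).

(** The second inequality says that the reflection [y -> a * x - y] increases [y]; the induction
    needs it to keep the first coordinate positive. *)
Lemma coxeter_orbit_bounds k (P := coxeter_orbit k) :
  0 < P.1 /\ 2 * P.2 < a * P.1.
Proof.
rewrite {}/P /coxeter_orbit; elim: k => [|k] /=; first by rewrite ltr01 mulr0 mulr1.
set P := iter k _ _; case: P => x y /= [x0 hy].
have h1 : 0 <= (a * b - 4) * x by apply: mulr_ge0; [rewrite subr_ge0 | exact: ltW].
have h2 : 0 < b * (a * x - 2 * y) by rewrite mulr_gt0 ?subr_gt0.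
have h3 : 0 <= (a * b - 4) * (a * x - y).
  by rewrite mulr_ge0 ?subr_ge0 //; have := mulr_gt0 a_gt0 x0; lra.
by split; lra.
Qed.

(** The form is both [a * x ^+ 2 - b * (y * (a * x - y))] and [b * y ^+ 2 - a * (x * (b * y - x))],
    so each reflection preserves it. *)
Lemma coxeter_orbit_form k (P := coxeter_orbit k) :
  a * P.1 ^+ 2 - a * b * P.1 * P.2 + b * P.2 ^+ 2 = a.
Proof.
rewrite {}/P; elim: k => [|k] /=; first by ring.
by set P := coxeter_orbit k; case: P => x y /= h; rewrite -[RHS]h; ring.
Qed.

Lemma coxeter_orbit_incr : {homo (fun k => (coxeter_orbit k).1) : k l / (k < l)%N >-> k < l}.
Proof.
apply: homo_ltn => [x y z|k]; first exact: lt_trans.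
have [] := coxeter_orbit_bounds k; rewrite /coxeter_orbit iterS.
case: (iter k _ _) => x y /= x0 hy.
have h1 : 0 <= (a * b - 4) * x by apply: mulr_ge0; [rewrite subr_ge0 | exact: ltW].
have h2 : 0 < b * (a * x - 2 * y) by rewrite mulr_gt0 ?subr_gt0.
by lra.
Qed.

Definition coxeter_slope k := (coxeter_orbit k).2 / (coxeter_orbit k).1.

(** Two orbit points on one line through the origin have the same value [a != 0] of the quadratic
    form, hence first coordinates equal up to sign. These are positive and strictly increasing in
    the index. *)
Lemma coxeter_slope_inj : injective coxeter_slope.
Proof.
move=> k l; rewrite /coxeter_slope => e.
have [xk _] := coxeter_orbit_bounds k; have [xl _] := coxeter_orbit_bounds l.
have := coxeter_orbit_form k; have := coxeter_orbit_form l.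
have e1 : (coxeter_orbit k).2 * (coxeter_orbit l).1
        = (coxeter_orbit l).2 * (coxeter_orbit k).1.
  by move/eqP: e; rewrite eqr_div ?(gt_eqF xk) ?(gt_eqF xl) // => /eqP.
have incr := coxeter_orbit_incr; move: e1 xk xl (incr k l) (incr l k).
case: (coxeter_orbit k) (coxeter_orbit l) => [x y] [x' y'] /= e1 x0 x0' i1 i2 f1 f2.
have e2 : a * (x ^+ 2 - x' ^+ 2) = 0.
  have -> : a * (x ^+ 2 - x' ^+ 2) = a * x ^+ 2 - a * x' ^+ 2 by ring.
  (* Each coefficient [a] is replaced by the form at the other point, which makes the collinearity
     determinant a factor. *)
  rewrite -[X in X * x ^+ 2]f1 -[X in _ - X * _]f2.
  transitivity ((y' * x - y * x') * (b * (y' * x + y * x') - a * b * x * x')).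
    by ring.
  by rewrite e1 subrr mul0r.
have exx' : x = x'.
  by move/eqP: e2; rewrite mulf_eq0 (gt_eqF a_gt0) /= subr_eq0 eqf_sqr => /orP[/eqP//|/eqP]; lra.
case: (ltngtP k l) => [/i1|/i2|//]; rewrite exx' ltxx //.
Qed.

Lemma poly_coxeter_slope_eq0 (p : {poly F}) :
  (forall k, p.[coxeter_slope k] = 0) -> p = 0.
Proof.
move=> hp; apply/eqP/negPn/negP => p0.
have := @max_poly_roots _ p [seq coxeter_slope k | k <- iota 0 (size p)] p0.
rewrite map_inj_uniq ?iota_uniq; last exact: coxeter_slope_inj.
rewrite size_map size_iota ltnn => h.
suff /h/(_ isT) : all (root p) [seq coxeter_slope k | k <- iota 0 (size p)] by [].
by apply/allP => _ /mapP[k _ ->]; apply/rootP.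
Qed.

Lemma poly_nonzero_eq0 (p : {poly F}) : (forall x, x != 0 -> p.[x] = 0) -> p = 0.
Proof.
move=> hp; apply/eqP/negPn/negP => p0.
have := @max_poly_roots _ p [seq k.+1%:R | k <- iota 0 (size p)] p0.
rewrite map_inj_uniq ?iota_uniq; last first.
  by move=> k l /eqP; rewrite eqr_nat => /eqP [].
rewrite size_map size_iota ltnn => h.
suff /h/(_ isT) : all (root p) [seq k.+1%:R | k <- iota 0 (size p)] by [].
by apply/allP => _ /mapP[k _ ->]; apply/rootP/hp; rewrite pnatr_eq0.
Qed.

End Orbit.

(** * The generators form a basis in each degree *)

Lemma horner_refl_gen (F : fieldType) (a b t : F) n k :
  (refl_gen a%:P b%:P 1 'X n k).[t] = refl_gen a b 1 t n k.
Proof.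
have := rmorph_refl_gen _ _ (horner_eval t) a%:P b%:P 1 'X n k.
by rewrite /= /horner_eval !hornerC hornerX => ->.
Qed.

Lemma comp_quadratic_eq0 (F : fieldType) (a : F) (p : {poly F}) :
  p \Po ('X * (a%:P - 'X)) = 0 -> p = 0.
Proof.
have sz : size (a%:P - 'X) = 2%N by rewrite -size_polyN opprB size_XsubC.
move/eqP; rewrite comp_poly_eq0 => [/eqP//|].
by rewrite size_mul ?size_polyX ?sz // -size_poly_eq0 ?size_polyX ?sz.
Qed.

Section GenBasis.
Variables (F : realFieldType) (a b : F).
Hypotheses (a_gt0 : 0 < a) (b_gt0 : 0 < b) (ab_ge4 : 4 <= a * b).
Local Notation ugen n k := (refl_gen a%:P b%:P 1 'X n k).

(** The relation is split at [n./2] into [h + g = 0], with homogenizations [H] and [G]. Since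
    [G = - H] off the line [x = 0], [G] inherits both invariances and vanishes on the orbit, so
    [g = 0]. Each half is then a polynomial in a single quadratic, and composition with a
    nonconstant polynomial is injective. *)
Lemma ugen_free n (v : nat -> F) :
  \sum_(k < n.+1) v k *: ugen n k = 0 -> forall k, (k <= n)%N -> v k = 0.
Proof.
rewrite (bigID (fun k : 'I_n.+1 => (k <= n./2)%N)) /=.
set h := \sum_(k < _ | _) _; set g := \sum_(k < _ | _) _ => hg.
pose H x y : F := \sum_(k < n.+1 | (k <= n./2)%N) v k * refl_gen a b x y n k.
pose G x y : F := \sum_(k < n.+1 | ~~ (k <= n./2)%N) v k * refl_gen a b x y n k.
have HE x y : x != 0 -> H x y = x ^+ n * h.[y / x].
  move=> x0; rewrite horner_sum mulr_sumr; apply: eq_bigr => k _.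
  by rewrite hornerZ horner_refl_gen mulrCA refl_gen_homog // -ltnS.
have GE x y : x != 0 -> G x y = x ^+ n * g.[y / x].
  move=> x0; rewrite horner_sum mulr_sumr; apply: eq_bigr => k _.
  by rewrite hornerZ horner_refl_gen mulrCA refl_gen_homog // -ltnS.
have GH x y : x != 0 -> G x y = - H x y.
  move=> x0; apply/eqP; rewrite -addr_eq0 GE // HE // -mulrDr -hornerD addrC hg.
  by rewrite horner0 mulr0.
have Hinv x y : H x (a * x - y) = H x y.
  apply: eq_bigr => k hk; rewrite /refl_gen hk; congr (_ * (_ * _ ^+ _)); ring.
have Ginv x y : G (b * y - x) y = G x y.
  apply: eq_bigr => k hk; rewrite /refl_gen (negbTE hk); congr (_ * (_ * _ ^+ _)); ring.
have G0 k : G (coxeter_orbit F a b k).1 (coxeter_orbit F a b k).2 = 0.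
  elim: k => [|k] /=.
    (* At (1, 0) every term of [G] contains [0 ^+ (k.*2 - n)] with a positive exponent, because
       [k > n./2]. *)
    apply: big1 => k hk; rewrite /refl_gen (negbTE hk) /= expr0n.
    by case: eqP => [|_]; [lia | rewrite mul0r mulr0].
  have [] := coxeter_orbit_bounds F a b a_gt0 b_gt0 ab_ge4 k.
  case: (coxeter_orbit _ _ _ k) => x y /= x0 _ <-.
  by rewrite Ginv !GH ?gt_eqF // Hinv.
have g0 : g = 0.
  apply: (poly_coxeter_slope_eq0 F a b) => // k.
  have [x0 _] := coxeter_orbit_bounds F a b a_gt0 b_gt0 ab_ge4 k.
  have := G0 k; rewrite GE ?gt_eqF // => /eqP.
  by rewrite mulf_eq0 expf_eq0 (gt_eqF x0) andbF => /eqP.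
have h0 : h = 0 by move: hg; rewrite g0 addr0.
have V0 : \poly_(k < n./2.+1) v k = 0.
  apply: (comp_quadratic_eq0 _ a).
  rewrite poly_def linear_sum /= -[RHS]h0 /h.
  rewrite (big_ord_widen n.+1 (fun k => (v k *: 'X^k) \Po ('X * (a%:P - 'X)))); last by lia.
  apply: eq_big => [k|k hk]; first by lia.
  by rewrite comp_polyZ comp_Xn_poly /refl_gen -ltnS hk expr1n mul1r mulr1.
have U0 : \poly_(j < n - n./2) v (n - j)%N = 0.
  (* Putting [y = 1] turns [G] into a polynomial in [x * (b - x)], with exponent [j = n - k]. Its
     vanishing is known only for [x != 0], which suffices over an infinite field. *)
  apply: (comp_quadratic_eq0 _ b); apply: (poly_nonzero_eq0 F) => x x0.
  transitivity (G x 1); last by rewrite GE // g0 horner0 mulr0.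
  rewrite horner_comp horner_poly /G.
  rewrite (big_ord_widen n.+1 (fun j => v (n - j)%N * _ ^+ j)); last by lia.
  rewrite (reindex_inj rev_ord_inj) /=; apply: eq_big => [k|k hk]; first by have := ltn_ord k; lia.
  have -> : (n - (n.+1 - k.+1) = k)%N by have := ltn_ord k; lia.
  have -> : (n.+1 - k.+1 = n - k)%N by lia.
  rewrite /refl_gen ifF ?expr1n; last by lia.
  by rewrite !hornerE /= mulr1.
move=> k le_kn; case: (leqP k n./2) => hk.
  by move/(congr1 (fun p : {poly F} => p`_k)): V0; rewrite coef_poly ltnS hk coef0.
move/(congr1 (fun p : {poly F} => p`_(n - k))): U0.
rewrite coef_poly coef0 ifT; last by lia.
by rewrite subKn.
Qed.

Lemma ugen_size n k : (k <= n)%N -> (size (ugen n k) <= n.+1)%N.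
Proof.
move=> le_kn; have szX (p : {poly F}) d m : (size p <= d.+1)%N -> (size (p ^+ m) <= (d * m).+1)%N.
  by move=> hp; apply: leq_trans (size_poly_exp_leq _ _) _; nia.
have sz (c d : F) : (size (c%:P * 'X - d%:P)%R <= 2)%N.
  apply: leq_trans (size_polyD _ _) _; rewrite geq_max size_polyN.
  rewrite mul_polyC (leq_trans (size_scale_leq _ _)) ?size_polyX //.
  by rewrite (leq_trans (size_polyC_leq1 _)).
rewrite /refl_gen; case: (leqP k n./2) => hk; apply: leq_trans (size_polyMleq _ _) _.
  rewrite expr1n size_poly1 add1n /=; apply: (@leq_trans (2 * k).+1); last by lia.
  apply: szX; apply: leq_trans (size_polyMleq _ _) _; rewrite size_polyX.
  by have := sz 1 a; rewrite mul1r mulr1 -size_polyN opprB.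
rewrite size_polyXn addSn /=.
apply: (@leq_trans (k.*2 - n + (1 * (n - k)).+1)%N); last by lia.
by rewrite leq_add2l; apply: szX; rewrite mul1r; apply: sz.
Qed.

(** There are [n.+1] independent polynomials in a space of dimension [n.+1], so their coefficient
    matrix is invertible. *)
Lemma ugen_span n i : (i <= n)%N ->
  exists v : nat -> F, 'X^i = \sum_(k < n.+1) v k *: ugen n k.
Proof.
move=> le_in.
pose M : 'M[F]_n.+1 := \matrix_k poly_rV (ugen n k).
have rvM (u : 'rV_n.+1) : rVpoly (u *m M) = \sum_k u 0 k *: ugen n k.
  rewrite mulmx_sum_row linear_sum; apply: eq_bigr => k _.
  by rewrite linearZ /= rowK poly_rV_K // ugen_size // -ltnS.
have freeM : row_free M.
  rewrite -kermx_eq0; apply/rowV0P => u /sub_kermxP uM0.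
  have := rvM u; rewrite uM0 linear0 => /esym uM.
  apply/rowP => k; rewrite mxE -[k]inord_val.
  apply: (ugen_free n (fun k => u 0 (inord k))); last by rewrite -ltnS.
  by rewrite -[RHS]uM; apply: eq_bigr => l _; rewrite inord_val.
have unitM : M \in unitmx by rewrite -row_free_unit.
pose u := poly_rV 'X^i *m invmx M : 'rV[F]_n.+1.
exists (fun k => u 0 (inord k)).
under eq_bigr do rewrite inord_val.
by rewrite -rvM mulmxKV // poly_rV_K // size_polyXn.
Qed.

End GenBasis.

(** The univariate identity is evaluated at [y / x] in the fraction field of [S] and multiplied by
    [x ^+ n], which clears the denominators by homogeneity. *)
Lemma refl_gen_span (F : realFieldType) (S : idomainType) (phi : {rmorphism F -> S})
    (a b : F) (x y : S) n i :
  0 < a -> 0 < b -> 4 <= a * b -> x != 0 -> (i <= n)%N ->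
  exists v : nat -> F,
    x ^+ (n - i) * y ^+ i = \sum_(k < n.+1) phi (v k) * refl_gen (phi a) (phi b) x y n k.
Proof.
move=> a0 b0 ab x0 le_in; have [v hv] := ugen_span F a b a0 b0 ab n i le_in.
exists v.
pose K := {fraction S}; pose psi : {rmorphism F -> K} := @tofrac S \o phi.
pose t : K := @tofrac S y / @tofrac S x.
have cpsi : commr_rmorph psi t by move=> c; exact: mulrC.
have X0 : @tofrac S x != 0 :> K by rewrite tofrac_eq0.
apply/eqP; rewrite -tofrac_eq; apply/eqP.
move/(congr1 (fun p => @tofrac S x ^+ n * horner_morph cpsi p)): hv.
rewrite rmorphXn /= horner_morphX => hv.
rewrite rmorphM !rmorphXn /=.
transitivity (@tofrac S x ^+ n * t ^+ i).
  by rewrite -{2}(subnK le_in) exprD -mulrA -exprMn mulrCA divff // mulr1.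
rewrite {}hv !linear_sum mulr_sumr /= rmorph_sum; apply: eq_bigr => k _.
rewrite -mul_polyC !rmorphM /= horner_morphC mulrCA; congr (_ * _).
rewrite !rmorph_refl_gen /= !horner_morphC horner_morphX rmorph1 refl_gen_homog //.
by rewrite -ltnS.
Qed.

(** * The two subalgebras in three variables, and their sum over an ordered field *)

Lemma big_ord3 (V : nmodType) (f : 'I_3 -> V) :
  \sum_(i < 3) f i = f 0%R + f 1%R + f 2%R.
Proof.
rewrite !big_ord_recl big_ord0 addr0 addrA.
by congr (_ + f _ + f _); exact: val_inj.
Qed.

Section SumOfSubalgebras.
Variables (R : comRingType) (A : 'M[int]_3).
Hypothesis diagA : forall i, A i i = 2.

Local Notation x := (omega R (0%R : 'I_3)).
Local Notation y := (omega R (1%R : 'I_3)).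
Local Notation z := (omega R (2%R : 'I_3)).
Local Notation cst i j := ((- A i j)%:~R : {mpoly R[3]}).

Lemma mpoly_scaler_int (c : int) (p : {mpoly R[3]}) : c%:~R *: p = c%:~R * p.
Proof. by rewrite scaler_int mulrzl. Qed.

Lemma omega_sub_alpha0 :
  x - alpha R A 0%R = cst 1%R 0%R * y - x + z * cst 2%R 0%R.
Proof.
rewrite /alpha big_ord3 diagA !mpoly_scaler_int !rmorphN /=.
have -> : (2 : int)%:~R = 2 :> {mpoly R[3]} by [].
ring.
Qed.

Lemma omega_sub_alpha1 :
  y - alpha R A 1%R = cst 0%R 1%R * x - y + z * cst 2%R 1%R.
Proof.
rewrite /alpha big_ord3 diagA !mpoly_scaler_int !rmorphN /=.
have -> : (2 : int)%:~R = 2 :> {mpoly R[3]} by [].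
ring.
Qed.

Lemma mpolyX3 (m : 'X_{1..3}) :
  'X_[m] = x ^+ m 0%R * y ^+ m 1%R * z ^+ m 2%R.
Proof.
rewrite mpolyXE_id !big_ord_recl big_ord0 mulr1 mulrA.
by congr (_ * 'X__ ^+ m _ * 'X__ ^+ m _); exact: val_inj.
Qed.

Section Subalg.
Variables f0 f1 f2 : {mpoly R[3]}.
Local Notation E := (subalg3 f0 f1 f2).

Lemma subalg3D p q : E p -> E q -> E (p + q).
Proof. by move=> [u ->] [v ->]; exists (u + v); rewrite rmorphD. Qed.

Lemma subalg3M p q : E p -> E q -> E (p * q).
Proof. by move=> [u ->] [v ->]; exists (u * v); rewrite rmorphM. Qed.

Lemma subalg3C c : E c%:MP.
Proof. by exists c%:MP; rewrite comp_mpolyC. Qed.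

Lemma subalg3X p n : E p -> E (p ^+ n).
Proof. by move=> [u ->]; exists (u ^+ n); rewrite rmorphXn. Qed.

Lemma subalg3_0 : E f0.
Proof. by exists 'X_(0%R); rewrite comp_mpolyXU. Qed.

Lemma subalg3_1 : E f1.
Proof. by exists 'X_(1%R); rewrite comp_mpolyXU. Qed.

Lemma subalg3_2 : E f2.
Proof. by exists 'X_(2%R); rewrite comp_mpolyXU. Qed.

End Subalg.

Lemma alg_sumD (p q : {mpoly R[3]}) : alg_sum A p -> alg_sum A q -> alg_sum A (p + q).
Proof.
move=> [u [v [hu hv ->]]] [u' [v' [hu' hv' ->]]]; exists (u + u'), (v + v').
by split; [apply: subalg3D | apply: subalg3D | rewrite addrACA].
Qed.

Lemma alg_sumC c (p : {mpoly R[3]}) : alg_sum A p -> alg_sum A (c%:MP * p).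
Proof.
move=> [u [v [hu hv ->]]]; exists (c%:MP * u), (c%:MP * v).
by split; [apply/subalg3M/hu/subalg3C | apply/subalg3M/hv/subalg3C | rewrite mulrDr].
Qed.

Lemma alg_sumMz (p : {mpoly R[3]}) : alg_sum A p -> alg_sum A (z * p).
Proof.
move=> [u [v [hu hv ->]]]; exists (z * u), (z * v).
by split; [apply/subalg3M/hu/subalg3_2 | apply/subalg3M/hv/subalg3_2 | rewrite mulrDr].
Qed.

Lemma alg_sum_l p :
  subalg3 (x * (x - alpha R A 0%R)) y z p -> alg_sum A p.
Proof.
by move=> hp; exists p, 0; split; rewrite ?addr0 // -mpolyC0; apply: subalg3C.
Qed.

Lemma alg_sum_r p :
  subalg3 x (y * (y - alpha R A 1%R)) z p -> alg_sum A p.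
Proof.
by move=> hp; exists 0, p; split; rewrite ?add0r // -mpolyC0; apply: subalg3C.
Qed.

Lemma alg_sum0 : alg_sum A (0 : {mpoly R[3]}).
Proof. by apply: alg_sum_l; rewrite -mpolyC0; apply: subalg3C. Qed.

Lemma alg_sum_monomials (p : {mpoly R[3]}) :
  {in msupp p, forall m, alg_sum A ('X_[m] : {mpoly R[3]})} -> alg_sum A p.
Proof.
move=> hp; rewrite [p]mpolyE big_seq_cond; elim/big_rec: _ => [|m q hm hq].
  exact: alg_sum0.
apply: alg_sumD => //; rewrite -mul_mpolyC; apply/alg_sumC/hp.
by case/andP: hm.
Qed.

(** Replacing the quadratic invariants by their reductions modulo z costs a multiple of z. *)
Lemma refl_gen_sub_homog n k (a b c d : {mpoly R[3]}) :
  (k <= n)%N -> a \is 0.-homog -> b \is 0.-homog -> c \is 0.-homog -> d \is 0.-homog ->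
  exists2 r : {mpoly R[3]}, r \is n.-1.-homog &
    refl_gen a b x y n k =
     (if (k <= n./2)%N then x ^+ (n - k.*2) * (y * (a * x - y + z * d)) ^+ k
      else y ^+ (k.*2 - n) * (x * (b * y - x + z * c)) ^+ (n - k)) - z * r.
Proof.
move=> le_kn ha hb hc hd.
have hX i : omega R i \is 1.-homog by rewrite dhomogX; apply/eqP/mdeg1.
have key (u s t e : {mpoly R[3]}) i j : u \is i.-homog -> s \is 1.-homog ->
    t \is 1.-homog -> e \is 0.-homog -> (i + j.*2 = n)%N ->
    exists2 r : {mpoly R[3]}, r \is n.-1.-homog &
      u * (s * t) ^+ j = u * (s * (t + z * e)) ^+ j - z * r.
  move=> hu hs ht he hn.
  (* The two bases differ by [z * (s * e)]; the last factor is the cofactor in the difference of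
     their [j]-th powers, of degree [2 * (j - 1)] when [j > 0]. *)
  exists (u * (s * e * \sum_(l < j) (s * (t + z * e)) ^+ (j.-1 - l) * (s * t) ^+ l)).
    case: j hn => [|j] hn; first by rewrite big_ord0 !mulr0 dhomog0.
    have -> : n.-1 = (i + (1 + 0 + j.*2))%N by lia.
    apply: dhomogM => //; apply: dhomogM; first exact: dhomogM.
    apply: rpred_sum => l _.
    have -> : j.*2 = (2 * (j.+1.-1 - l) + 2 * l)%N by have := ltn_ord l; lia.
    apply: dhomogM; apply: dhomogMn; apply: (@dhomogM _ _ _ 1 _ 1) => //.
    by apply: rpredD => //; apply: (@dhomogM _ _ _ 1 _ 0).
  rewrite -[(s * t) ^+ j](subKr ((s * (t + z * e)) ^+ j)) subrXX mulrBr.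
  congr (_ - _); move: (\sum_(l < j) _) => T.
  ring.
rewrite /refl_gen; case: ifP => hk.
  apply: (key _ _ _ _ (n - k.*2)%N) => //; last by lia.
    by have := dhomogMn (n - k.*2) (hX 0%R); rewrite mul1n.
  by apply: rpredB => //; apply: (@dhomogM _ _ _ 0 _ 1).
apply: (key _ _ _ _ (k.*2 - n)%N) => //; last by lia.
  by have := dhomogMn (k.*2 - n) (hX 1%R); rewrite mul1n.
by apply: rpredB => //; apply: (@dhomogM _ _ _ 0 _ 1).
Qed.

End SumOfSubalgebras.

(** Strong induction on the degree of a monomial. If z divides it, the quotient has smaller degree
    and the sum is stable under multiplication by z. Otherwise it is a combination of the
    generators, each in one of the subalgebras up to z times a form of degree [n.-1]. *)
Lemma alg_sum_full (F : realFieldType) (A : 'M[int]_3) (f : {mpoly F[3]}) :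
  is_gcm A -> 4 <= A 0%R 1%R * A 1%R 0%R -> alg_sum A f.
Proof.
move=> [diagA [offA _]] hA.
have a0 : 0 < - A 0%R 1%R by have := offA 0%R 1%R isT; have := offA 1%R 0%R isT; nia.
have b0 : 0 < - A 1%R 0%R by have := offA 0%R 1%R isT; have := offA 1%R 0%R isT; nia.
have homI (c : int) : (c%:~R : {mpoly F[3]}) \is 0.-homog.
  by apply: rpredMz; exact: dhomog1.
suff hX n m : mdeg m = n -> alg_sum A ('X_[m] : {mpoly F[3]}).
  by apply: alg_sum_monomials => m _; apply: hX.
elim/ltn_ind: n m => n IH m hm.
have IHr (r : {mpoly F[3]}) : (0 < n)%N -> r \is n.-1.-homog -> alg_sum A r.
  move=> n0 /dhomogP hr; apply: alg_sum_monomials => m' /hr hm'.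
  by apply: (IH n.-1) => //; lia.
have [n0|n0] := posnP n.
  move/eqP: hm; rewrite n0 mdeg_eq0 => /eqP ->; rewrite mpolyX0 -mpolyC1.
  exact/alg_sum_l/subalg3C.
rewrite mpolyX3.
have mdeg3 : n = (m 0%R + m 1%R + m 2%R)%N.
  rewrite -hm mdegE !big_ord_recl big_ord0 addn0 addnA.
  by congr (_ + m _ + m _)%N; exact: val_inj.
case e2 : (m 2%R) => [|m2]; last first.
  rewrite exprS mulrCA; apply: alg_sumMz; apply: IHr => //.
  have -> : n.-1 = (1 * m 0%R + 1 * m 1%R + 1 * m2)%N by lia.
  by apply: dhomogM; [apply: dhomogM|]; apply: dhomogMn; rewrite dhomogX; apply/eqP/mdeg1.
rewrite expr0 mulr1.
have -> : m 0%R = (n - m 1%R)%N by lia.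
have [|||||v ->] := @refl_gen_span F {mpoly F[3]} (@mpolyC 3 F) (- A 0%R 1%R)%:~R (- A 1%R 0%R)%:~R
  (omega F 0%R) (omega F 1%R) n (m 1%R).
- by rewrite ltr0z.
- by rewrite ltr0z.
- by rewrite -rmorphM /= mulrNN (ler_int F 4).
- by rewrite -msupp_eq0 msuppX.
- by lia.
elim/big_rec: _ => [|k q _ hq]; first exact: alg_sum0.
apply: alg_sumD hq; apply: alg_sumC; rewrite !rmorph_int.
have le_kn : (k <= n)%N by rewrite -ltnS.
have [r hr ->] := @refl_gen_sub_homog F n k (- A 0%R 1%R)%:~R (- A 1%R 0%R)%:~R
  (- A 2%R 0%R)%:~R (- A 2%R 1%R)%:~R le_kn (homI _) (homI _) (homI _) (homI _).
apply: alg_sumD; last first.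
  by rewrite -[- (_ * r)]scaleN1r -mul_mpolyC; exact/alg_sumC/alg_sumMz/IHr.
case: ifP => _; [rewrite -(omega_sub_alpha1 F A) // | rewrite -(omega_sub_alpha0 F A) //].
  apply: alg_sum_r; apply: subalg3M; apply: subalg3X; [exact: subalg3_0 | exact: subalg3_1].
apply: alg_sum_l; apply: subalg3M; apply: subalg3X; [exact: subalg3_1 | exact: subalg3_0].
Qed.

(** * From the subalgebras to the invariants *)

Lemma subalg3_invariants (R : comRingType) (A : 'M[int]_3) (j : 'I_3)
    (f0 f1 f2 p : {mpoly R[3]}) :
  sigma A j f0 = f0 -> sigma A j f1 = f1 -> sigma A j f2 = f2 ->
  subalg3 f0 f1 f2 p -> invariants A j p.
Proof.
move=> h0 h1 h2 [q ->] n; elim: n => [//|n IH]; rewrite iterS IH {IH n}.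
have ht i : sigma A j (tnth [tuple f0; f1; f2] i) = tnth [tuple f0; f1; f2] i.
  by case: i => [[|[|[|i]]] //= hi]; rewrite !(tnth_nth 0).
rewrite [q]mpolyE !rmorph_sum /sigma rmorph_sum; apply: eq_bigr => m _ /=.
rewrite !comp_mpolyZ !comp_mpolyX rmorph_prod; congr (_ *: _).
by apply: eq_bigr => i _; rewrite rmorphXn; congr (_ ^+ _); exact: ht.
Qed.

Lemma sigma_omega (R : comRingType) (A : 'M[int]_3) (i j : 'I_3) :
  sigma A j (omega R i) = if i == j then omega R i - alpha R A j else omega R i.
Proof. by rewrite /sigma comp_mpolyXU -tnth_nth tnth_map tnth_ord_tuple. Qed.

(** The reflection negates [alpha R A j], hence exchanges the two factors. *)
Lemma sigma_root (R : comRingType) (A : 'M[int]_3) (j : 'I_3) : A j j = 2 ->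
  sigma A j (omega R j * (omega R j - alpha R A j)) = omega R j * (omega R j - alpha R A j).
Proof.
move=> Ajj; rewrite /sigma rmorphM rmorphB /= -!/(sigma A j _) sigma_omega eqxx.
have -> : sigma A j (alpha R A j) = - alpha R A j.
  rewrite {1}/alpha /sigma linear_sum /=.
  (* Only the term [i = j] changes, and its coefficient is [A j j = 2]. *)
  rewrite (eq_bigr (fun i => (A i j)%:~R *: omega R i - if i == j then 2 *: alpha R A j else 0)).
    rewrite sumrB -/(alpha R A j) -big_mkcond big_pred1_eq scaler_nat; ring.
  move=> i _; rewrite comp_mpolyZ -/(sigma A j _) sigma_omega.
  by case: eqP => [->|_]; rewrite ?subr0 // Ajj scalerBr.
by rewrite opprK subrK mulrC.
Qed.

Lemma alg_sum_invariants (R : comRingType) (A : 'M[int]_3) (p : {mpoly R[3]}) :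
  (forall i, A i i = 2) -> alg_sum A p ->
  sumsp (invariants A 0%R) (invariants A 1%R) p.
Proof.
move=> diagA [u [v [hu hv ->]]]; exists u, v; split => //.
- by apply: subalg3_invariants hu; rewrite ?sigma_root ?sigma_omega.
- by apply: subalg3_invariants hv; rewrite ?sigma_root ?sigma_omega.
Qed.

(** * Sums over a finite field and an alternating form *)

Lemma sum_involution_eq0 (T : finType) (V : zmodType) (tau : T -> T) (g : T -> V) :
  involutive tau -> (forall t, g (tau t) = - g t) ->
  (forall t, tau t = t -> g t = 0) -> \sum_t g t = 0.
Proof.
move=> tauK gN g0.
(* Comparing ranks selects one point of each pair exchanged by [tau]. Fixed points are treated
   apart, as [g t = - g t] does not force [g t = 0] in characteristic 2. *)
pose r (t : T) : nat := enum_rank t.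
rewrite (bigID (fun t => (r t < r (tau t))%N)) /=.
rewrite [X in _ + X](bigID (fun t => (r (tau t) < r t)%N)) /=.
rewrite [X in _ + (_ + X)]big1 ?addr0; last first.
  move=> t; rewrite -!leqNgt => /andP[h1 h2]; apply/g0/enum_rank_inj/val_inj/eqP.
  by rewrite eqn_leq h1 h2.
rewrite [X in _ + X](reindex_inj (inv_inj tauK)) /=.
rewrite [X in _ + X](eq_bigl (fun t => (r t < r (tau t))%N)); last first.
  by move=> t; rewrite tauK; case: ltngtP.
by rewrite (eq_bigr _ (fun t _ => gN t)) sumrN subrr.
Qed.

(** As ['X^k - 1] has at most [k] roots, some [c != 0] has [c ^+ k != 1]; the substitution of
    [c * t] for [t] multiplies the sum by [c ^+ k]. *)
Lemma sum_expr_eq0 (F : finFieldType) k :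
  (0 < k < #|F|.-1)%N -> \sum_(t : F) t ^+ k = 0.
Proof.
move=> /andP[k0 kF].
have [c /andP[c0 ck]] : exists c : F, (c != 0) && (c ^+ k != 1).
  apply/existsP; apply: contraT => /existsPn hk.
  have := @max_poly_roots _ ('X^k - 1 : {poly F}) (enum (predC1 (0 : F))).
  rewrite -size_poly_gt0 size_XnsubC // enum_uniq -cardE cardC1 => /(_ isT) h.
  suff /h/(_ isT) : all (root ('X^k - 1)) (enum (predC1 (0 : F))) by rewrite ltnS leqNgt kF.
  apply/allP => c; rewrite mem_enum => c0; have := hk c; rewrite negb_and negbK.
  rewrite (negbTE c0) negbK /= => /eqP hc.
  by rewrite rootE !hornerE hc subrr.
have : (1 - c ^+ k) * \sum_(t : F) t ^+ k = 0.
  rewrite mulrBl mul1r {1}(reindex_inj (mulfI c0)) /= mulr_sumr.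
  by apply/eqP; rewrite subr_eq0; apply/eqP/eq_bigr => t _; rewrite exprMn.
by move/eqP; rewrite mulf_eq0 subr_eq0 eq_sym (negbTE ck) => /eqP.
Qed.

Lemma sum_expr_card_pred (F : finFieldType) : \sum_(t : F) t ^+ #|F|.-1 = -1.
Proof.
have F1 := finNzRing_gt1 F.
rewrite (bigD1 0) //= expr0n -subn1 subn_eq0 leqNgt F1 add0r.
rewrite (eq_bigr (fun=> 1)) => [|t t0]; last first.
  apply: (mulfI t0); rewrite -exprS subn1 prednK ?expf_card ?mulr1 //; exact: ltnW.
(* Translation invariance of the sum gives [#|F| = 0] in [F]. *)
have : \sum_(t : F) (t + 1) = \sum_(t : F) t.
  by rewrite [RHS](reindex_inj (addIr 1)).
rewrite big_split sumr_const /= -[RHS]addr0 => /addrI cF.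
by rewrite sumr_const cardC1; apply/eqP; rewrite -addr_eq0 -mulrSr prednK ?(ltnW F1) ?cF.
Qed.

Section FrobeniusForm.
Variables (p : nat) (F : finFieldType).
Hypothesis charF : p \in [pchar F].

(** Up to sign this is the Moore determinant of [x] and [y]. *)
Definition frob_form (x y : F) : F := x ^+ p * y - x * y ^+ p.

Lemma frob_form_reflect (b : int) (x y : F) :
  frob_form (b%:~R * y - x) y = - frob_form x y.
Proof.
rewrite /frob_form -!(pFrobenius_autE charF) rmorphB rmorphM rmorph_int /=.
ring.
Qed.

(** The reflection preserves the argument of [g] and negates the form. At a fixed point twice the
    form is 0; if [2 = 0], being fixed means [b * y = 0], so [y = 0] and the form vanishes again. *)
Lemma sum_frob_form_eq0 (b : int) (y : F) (g : F -> F) :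
  ((b%:~R : F) != 0) || (2 != 0 :> F) ->
  \sum_x g (x * (b%:~R * y - x)) * frob_form x y = 0.
Proof.
move=> hb; apply: (sum_involution_eq0 _ _ (fun x => b%:~R * y - x)) => [x|x|x hx].
- by rewrite opprB addrCA subrr addr0.
- by rewrite frob_form_reflect mulrN; congr (- (g _ * _)); ring.
have : 2 * frob_form x y = 0.
  by rewrite mulr_natl mulr2n -{2}hx frob_form_reflect subrr.
move/eqP; rewrite mulf_eq0 => /orP[/eqP h2|/eqP ->]; last by rewrite mulr0.
move: hb; rewrite h2 eqxx orbF => b0; suff -> : y = 0.
  have p0 := prime_gt0 (pcharf_prime charF).
  by rewrite /frob_form expr0n (gtn_eqF p0) !mulr0 subrr mulr0.
apply/eqP; move/eqP: hx; rewrite subr_eq -mulr2n -mulr_natl h2 mul0r mulf_eq0.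
by rewrite (negbTE b0).
Qed.

End FrobeniusForm.

(** * Reduction modulo z, and properness detected over a finite field *)

Lemma mmap_comp_mpoly (n k : nat) (R S : comNzRingType) (phi : {rmorphism R -> S})
    (h : 'I_k -> S) (t : n.-tuple {mpoly R[k]}) (q : {mpoly R[n]}) :
  mmap phi h (q \mPo t) = mmap phi (fun i => mmap phi h (tnth t i)) q.
Proof.
rewrite [q]mpolyE (raddf_sum (comp_mpoly t)) !raddf_sum; apply: eq_bigr => m _ /=.
rewrite comp_mpolyZ comp_mpolyX !mmapZ mmapX rmorph_prod; congr (_ * _).
by apply: eq_bigr => i _; rewrite rmorphXn.
Qed.

(** The target is general so as to cover both points over a finite field and the two indeterminates
    of a polynomial ring. *)
Definition eval_plane {R S : comNzRingType} (phi : {rmorphism R -> S}) (x y : S) :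
  {mpoly R[3]} -> S := mmap phi (tnth [tuple x; y; 0]).

Lemma eval_planeE (R S : comNzRingType) (phi : {rmorphism R -> S}) (x y : S) q :
  eval_plane phi x y q =
  \sum_(m <- msupp q) phi q@_m * (x ^+ m 0%R * y ^+ m 1%R * 0 ^+ m 2%R).
Proof.
rewrite /eval_plane /mmap; apply: eq_bigr => m _; congr (_ * _).
rewrite /mmap1 !big_ord_recl big_ord0 mulr1 mulrA !(tnth_nth 0) /=.
by congr (_ ^+ m _ * _ ^+ m _ * _ ^+ m _); exact: val_inj.
Qed.

Lemma alg_sum_eval_plane (R S : comNzRingType) (phi : {rmorphism R -> S})
    (A : 'M[int]_3) (f : {mpoly R[3]}) :
  (forall i, A i i = 2) -> alg_sum A f -> exists u v, forall x y,
  eval_plane phi x y f =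
    eval_plane phi (x * ((- A 1%R 0%R)%:~R * y - x)) y u +
    eval_plane phi x (y * ((- A 0%R 1%R)%:~R * x - y)) v.
Proof.
move=> diagA [_ [_ [[u ->] [v ->] ->]]]; exists u, v => x y.
rewrite /eval_plane rmorphD /= !mmap_comp_mpoly.
have hX i : mmap phi (tnth [tuple x; y; 0]) (omega R i) = tnth [tuple x; y; 0] i.
  by rewrite mmapX mmap1U.
congr (_ + _); apply: eq_bigr => m _; congr (_ * _); apply: mmap1_eq;
  case=> [[|[|[|i]]] //= hi]; rewrite !(tnth_nth 0) /= ?omega_sub_alpha0 ?omega_sub_alpha1 //;
  rewrite ?(rmorphM, rmorphB, rmorphD) ?rmorph_int /= !hX !(tnth_nth 0) /= ?rmorph_int; ring.
Qed.

(** The field has [p ^ 2] elements because the form vanishes identically on the prime field. *)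
Lemma alg_sum_proper_finfield (R : comNzRingType) (F : finFieldType) (p : nat)
    (phi : {rmorphism R -> F}) (A : 'M[int]_3) :
  p \in [pchar F] -> #|F| = (p ^ 2)%N -> (forall i, A i i = 2) ->
  (((- A 1%R 0%R)%:~R : F) != 0) || (2 != 0 :> F) ->
  (((- A 0%R 1%R)%:~R : F) != 0) || (2 != 0 :> F) ->
  ~ (forall f : {mpoly R[3]}, alg_sum A f).
Proof.
move=> charF cardF diagA b0 a0 hall.
have p1 := prime_gt1 (pcharf_prime charF).
set q := #|F| in cardF.
have q_gt : (p.*2 <= q)%N by rewrite cardF; nia.
(* Multiplied by the form, [f] yields [x ^+ q.-1 * y ^+ q.-1], whose sum is [(-1) * (-1) = 1], minus
   a term in [x ^+ (q - p)], whose sum is 0 because [0 < q - p < q.-1]. *)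
pose f : {mpoly R[3]} := 'X_(0%R) ^+ (q.-1 - p) * 'X_(1%R) ^+ (q - 2).
have [u [v huv]] := alg_sum_eval_plane _ _ phi A f diagA (hall f).
pose L (g : F -> F -> F) := \sum_x \sum_y g x y * frob_form p F x y.
have LU : L (fun x y => eval_plane phi (x * ((- A 1%R 0%R)%:~R * y - x)) y u) = 0.
  rewrite /L exchange_big /= big1 // => y _.
  exact: (sum_frob_form_eq0 p F charF _ y (fun t => eval_plane phi t y u)).
have LV : L (fun x y => eval_plane phi x (y * ((- A 0%R 1%R)%:~R * x - y)) v) = 0.
  rewrite /L big1 // => x _.
  have := sum_frob_form_eq0 p F charF _ x (fun t => eval_plane phi x t v) a0.
  (* The reflection now acts on [y]; exchanging the variables changes the sign of the form. *)
  move/eqP; rewrite -oppr_eq0 -sumrN => /eqP {2}<-; apply: eq_bigr => y _.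
  by rewrite -mulrN; congr (_ * _); rewrite /frob_form; ring.
have : L (fun x y => eval_plane phi x y f) = 0.
  rewrite -[RHS]addr0 -{1}LU -LV /L -big_split; apply: eq_bigr => x _ /=.
  by rewrite -big_split; apply: eq_bigr => y _ /=; rewrite huv mulrDl.
have fE x y : eval_plane phi x y f = x ^+ (q.-1 - p) * y ^+ (q - 2).
  by rewrite /eval_plane /f rmorphM !rmorphXn /= !mmapX !mmap1U !(tnth_nth 0).
have wE x y : x ^+ (q.-1 - p) * y ^+ (q - 2) * frob_form p F x y =
    x ^+ q.-1 * y ^+ q.-1 - x ^+ (q - p) * y ^+ (q - 2 + p).
  rewrite /frob_form mulrBr mulrACA -exprD -exprSr; congr (_ * _ ^+ _ - _).
  - by congr (_ ^+ _); lia.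
  - by lia.
  by rewrite mulrACA -exprSr -exprD; congr (_ ^+ _ * _); lia.
rewrite /L (eq_bigr (fun x => x ^+ q.-1 * (\sum_y y ^+ q.-1) -
    x ^+ (q - p) * (\sum_y y ^+ (q - 2 + p)))); last first.
  move=> x _; rewrite !mulr_sumr -sumrB; apply: eq_bigr => y _.
  by rewrite fE wE.
rewrite sumrB -!mulr_suml (sum_expr_eq0 _ (q - p)) ?mul0r; last by rewrite /q; lia.
rewrite sum_expr_card_pred mulrNN mulr1 subr0 => /eqP.
by rewrite oner_eq0.
Qed.

(** * Characteristic 2 with a reflection that is trivial modulo 2 *)

Lemma coef1_linear_exp (B : comNzRingType) (c d : B) j :
  ((c%:P + d *: 'X) ^+ j)`_1 = c ^+ j.-1 * d *+ j.
Proof.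
have := coef_deriv ((c%:P + d *: 'X) ^+ j) 0.
rewrite mulr1n => <-; rewrite deriv_exp coefMn -!horner_coef0 hornerM.
have -> : (c%:P + d *: 'X)^`() = d%:P by rewrite derivD derivC derivZ derivX add0r alg_polyC.
by rewrite horner_exp hornerD hornerZ hornerX !hornerC mulr0 addr0 mulrC.
Qed.

Section CharTwo.
Variable (R : comNzRingType).
Hypothesis two0 : 2 = 0 :> R.
Local Notation RXY := {poly {poly R}}.
Local Notation X := ('X : RXY).
Local Notation Y := (('X : {poly R})%:P : RXY).

(** For [b = 0] the quadratic invariant is [- X ^+ 2], so only even powers of [X] occur. *)
Lemma coef_square_monomial (i j : nat) : ((X * (0 * Y - X)) ^+ i * Y ^+ j)`_1 = 0.
Proof.
rewrite mul0r sub0r mulrN -expr2 exprNn -exprM -rmorphXn /= coefMC.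
rewrite -(rmorph_sign (@polyC _)) coefCM coefXn.
by rewrite (_ : (1 == 2 * i)%N = false) ?mulr0 ?mul0r //; lia.
Qed.

(** For [i = 1] the coefficient of [X] is a power of [- Y ^+ 2], of even degree. For [i = 0] it has
    degree [2 * j - 1] in [Y], which is 3 only for [j = 2], and then the factor [j] is 0 in [R]. *)
Lemma coef_quadratic_monomial (c : R) (i j : nat) :
  ((X ^+ i * (Y * (c%:P%:P * X - Y)) ^+ j)`_1)`_3 = 0.
Proof.
have E : Y * (c%:P%:P * X - Y) = (- 'X^2)%:P + (c *: 'X) *: X.
  rewrite -mul_polyC -[c *: _]mul_polyC !rmorphM rmorphN /= expr2 rmorphM /=; ring.
rewrite E coefXnM; case: i => [|[|i]] /=; rewrite ?coef0 //.
  rewrite subn0 coef1_linear_exp exprNn -exprM -(rmorph_sign (@polyC _)).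
  rewrite mul_polyC -scalerAl -scalerAr -exprSr !coefMn !coefZ coefXn.
  case: eqP => [j3|_]; last by rewrite !mulr0 mul0rn.
  have -> : j = 2%N by lia.
  by rewrite -[_ *+ 2]mulr_natr two0 mulr0.
rewrite subnn -horner_coef0 horner_exp hornerD hornerZ hornerX hornerC mulr0 addr0.
rewrite exprNn -exprM -(rmorph_sign (@polyC _)) coefCM coefXn.
by rewrite (_ : (3 == 2 * j)%N = false) ?mulr0 //; lia.
Qed.

(** If b = 0 in R, neither subalgebra has an element with x y^3 in its reduction modulo z; if a = 0,
    the same holds for x^3 y. *)
Lemma alg_sum_proper_char2 (A : 'M[int]_3) : (forall i, A i i = 2) ->
  ((A 1%R 0%R)%:~R == 0 :> R) || ((A 0%R 1%R)%:~R == 0 :> R) ->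
  ~ (forall f : {mpoly R[3]}, alg_sum A f).
Proof.
move=> diagA hA hall.
pose phi : {rmorphism R -> RXY} := polyC \o polyC.
have phiI (c : int) : (c%:~R : RXY) = (c%:~R)%:P%:P by rewrite -[RHS]/(phi _) rmorph_int.
have mon (i j : nat) (s t : RXY) :
    eval_plane phi s t ('X_(0%R) ^+ i * 'X_(1%R) ^+ j) = s ^+ i * t ^+ j.
  by rewrite /eval_plane rmorphM !rmorphXn /= !mmapX !mmap1U !(tnth_nth 0).
have coef_eval (s t : RXY) q (k l : nat) : (forall i j, (s ^+ i * t ^+ j : RXY)`_k`_l = 0) ->
    (eval_plane phi s t q)`_k`_l = 0.
  move=> hst; rewrite eval_planeE !coef_sum big1 // => m _.
  rewrite /phi /= coefCM coefCM; case: (m 2%R) => [|n].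
    by rewrite expr0 mulr1 hst mulr0.
  by rewrite expr0n mulr0 !coef0 mulr0.
case/orP: hA => /eqP h0.
- have [u [v /(_ X Y)]] := alg_sum_eval_plane _ _ phi A _ diagA (hall ('X_(0%R) ^+ 1 * 'X_(1%R) ^+ 3)).
  move/(congr1 (fun s : RXY => s`_1`_3)); rewrite mon !coefD coef_eval; last first.
    by move=> i j; rewrite phiI rmorphN /= h0 oppr0 !polyC0 coef_square_monomial coef0.
  rewrite coef_eval; last by move=> i j; rewrite phiI coef_quadratic_monomial.
  by rewrite addr0 expr1 -rmorphXn /= coefMC coefX mul1r coefXn => /eqP; rewrite oner_eq0.
(* Evaluation at [Y], [X] exchanges the variables, so the same coefficient now reads off x^3 y. *)
have [u [v /(_ Y X)]] := alg_sum_eval_plane _ _ phi A _ diagA (hall ('X_(0%R) ^+ 3 * 'X_(1%R) ^+ 1)).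
move/(congr1 (fun s : RXY => s`_1`_3)); rewrite mon !coefD coef_eval; last first.
  by move=> i j; rewrite mulrC phiI coef_quadratic_monomial.
rewrite coef_eval; last first.
  by move=> i j; rewrite mulrC phiI rmorphN /= h0 oppr0 !polyC0 coef_square_monomial coef0.
by rewrite addr0 expr1 -rmorphXn /= coefCM coefX mulr1 coefXn => /eqP; rewrite oner_eq0.
Qed.

End CharTwo.

Theorem theorem7p1 (A : 'M[int]_3) (p : nat) :
  infinite_type A -> prime p ->
  (4 <= A 0%R 1%R * A 1%R 0%R)%R ->
  ((forall f : {mpoly rat[3]},
      sumsp (invariants A 0%R) (invariants A 1%R) f) /\
   (forall f : {mpoly rat[3]},
      sumsp (invariants A 0%R) (invariants A 1%R) f <-> alg_sum A f)) /\
  ~ (forall f : {mpoly 'F_p[3]}, alg_sum A f).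
Proof.
move=> [gcmA _] p_pr hA; have [diagA _] := gcmA.
have full (f : {mpoly rat[3]}) : alg_sum A f by exact: alg_sum_full.
have inv (f : {mpoly rat[3]}) := alg_sum_invariants _ _ f diagA (full f).
(* Both sides of the equivalence hold for every [f]. *)
split; first by split=> // f; split.
have [h|] := boolP ((2 == 0 :> 'F_p) &&
    (((A 1%R 0%R)%:~R == 0 :> 'F_p) || ((A 0%R 1%R)%:~R == 0 :> 'F_p))).
  by case/andP: h => /eqP two0; exact: alg_sum_proper_char2.
move=> h; have [F charF cardF] := pPrimePowerField p_pr (isT : (0 < 2)%N).
pose K : finFieldType := pPrimeCharType charF.
pose phi : {rmorphism 'F_p -> K} := GRing.in_alg (pPrimeCharType charF).
(* Injectivity of the embedding carries the conditions on [2], [a] and [b] from the prime field to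
   [K]. *)
have nz (c : 'F_p) : (phi c == 0) = (c == 0) by exact: fmorph_eq0.
have phiI (c : int) : (c%:~R : K) = phi c%:~R by rewrite rmorph_int.
have phi2 : (2 : K) = phi 2 by rewrite rmorph_nat.
apply: (alg_sum_proper_finfield _ K p phi A) => //; rewrite phi2 phiI !nz.
  by apply: contraR h; rewrite negb_or !negbK rmorphN oppr_eq0 => /andP[-> ->].
by apply: contraR h; rewrite negb_or !negbK rmorphN oppr_eq0 => /andP[-> ->]; rewrite orbT.
Qed.
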